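(* Let $k\ge 1$ be an integer, $D\in\mathbb{N}\cup\{0\}$ and $L\in\mathbb{N}$. Let $(X,\mathbb{Z}^k,T)$ be an extension of $(Y,\mathbb{Z}^k,S)$ with factor map $\pi:X\to Y$. Assume that $\dim_{Rok}(Y,\mathbb{Z}^k)=D$ and $\operatorname{mdim}(X)<L/2$. Then the set of functions $$\left\{f\in C(X,[0,1]^{(D+1)L}) : I_f\times\pi\ \text{is an embedding}\right\}$$ is a dense $G_\delta$ subset of $C(X,[0,1]^{(D+1)L})$. In particular, there exists an embedding from $(X,\mathbb{Z}^k,T)$ into $\bigl(([0,1]^{(D+1)L})^{\mathbb{Z}^k}\times Y,\ \sigma\times S\bigr)$.
   Context: $\mathbb{N}=\{1,2,\dots\}$. A $\mathbb{Z}^k$-action (dynamical system) $(X,\mathbb{Z}^k)=(X,\mathbb{Z}^k,T)$ is a continuous action of $\mathbb{Z}^k$ on a compact metric space $X$, written $(g,x)\mapsto gx$. A factor map $\pi:X\to Y$ between two $\mathbb{Z}^k$-actions is a continuous surjective equivariant map; $X$ is then called an extension of $Y$. An embedding of one $\mathbb{Z}^k$-action into another is a continuous injective equivariant map. $C(X,[0,1]^N)$ is the space of continuous functions with the supremum norm topology; a $G_\delta$ set is a countable intersection of open sets. Shift: for $N\in\mathbb{N}$, $\sigma$ is the action of $\mathbb{Z}^k$ on $([0,1]^N)^{\mathbb{Z}^k}$ (product topology) where $m\in\mathbb{Z}^k$ sends $(x_n)_{n}$ to $(x_{n+m})_{n}$. For $f\in C(X,[0,1]^N)$, $I_f:X\to([0,1]^N)^{\mathbb{Z}^k}$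 is the continuous equivariant map $I_f(x)=(f(wx))_{w\in\mathbb{Z}^k}$, and $I_f\times\pi$ is the map $x\mapsto(I_f(x),\pi(x))$. $\sigma\times S$ is the diagonal action. Mean dimension: for a compact metric space $(X,d)$ and $\epsilon>0$, $\operatorname{widim}_\epsilon(X,d)$ is the smallest integer $n$ such that $X$ has a finite open cover $\mathcal{U}$ all of whose members have diameter at most $\epsilon$ and whose order $-1+\max_{x}\#\{U\in\mathcal{U}:x\in U\}$ is $n$. With $[n]=\{0,\dots,n-1\}^k\subset\mathbb{Z}^k$ and $d_{[n]}(x,y)=\max_{g\in[n]}d(gx,gy)$, where $d$ is the metric of $X$, $$\operatorname{mdim}(X)=\sup_{\epsilon>0}\lim_{n\to\infty}\frac{\operatorname{widim}_\epsilon(X,d_{[n]})}{n^k}$$ (the limit exists). Rokhlin dimension: $\dim_{Rok}(Y,\mathbb{Z}^k)$ is the smallest nonnegative integer $D$ such that for each $n\in\mathbb{N}$ there are $D+1$ open sets $U_0,\dots,U_D\subset Y$ such that (1) for each $0\le i\le D$, the sets $g\overline{U}_i$, $g\in[n]$, are pairwise disjoint; (2) $\bigcup_{i=0}^D\bigcup_{g\in[n]}gU_i=Y$. If no such integer exists, $\dim_{Rok}(Y,\mathbb{Z}^k)=\infty$. *)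

(* Defs.v *)
From HB Require Import structures.
From mathcomp Require Import all_boot all_order all_algebra.
From mathcomp Require Import finmap.
From mathcomp Require Import all_classical all_reals all_analysis.

Set Implicit Arguments.
Unset Strict Implicit.
Unset Printing Implicit Defensive.

Import Order.TTheory GRing.Theory Num.Theory.
Import numFieldNormedType.Exports.

Local Open Scope classical_set_scope.
Local Open Scope ring_scope.

(** [Z^k] is ['rV[int]_k], written additively.  It is discrete, so an action is
    continuous iff every group element acts by a continuous map. *)
Record Zk_action (k : nat) (X : topologicalType) := ZkAction {
  act :> 'rV[int]_k -> X -> X ;
  act0 : forall x, act 0 x = x ;
  actD : forall g h x, act (g + h) x = act g (act h x) ;
  act_continuous : forall g, continuous (act g) }.

Section Maps.
Context {k : nat} {X Y : topologicalType}.
Variables (T : Zk_action k X) (S : Zk_action k Y).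

Definition equivariant (phi : X -> Y) := forall g x, phi (T g x) = S g (phi x).

Definition factor_map (phi : X -> Y) :=
  [/\ continuous phi, range phi = [set: Y] & equivariant phi].

Definition embedding (phi : X -> Y) :=
  [/\ continuous phi, injective phi & equivariant phi].

Definition diag_fun (g : 'rV[int]_k) (p : X * Y) := (T g p.1, S g p.2).

Lemma diag0 p : diag_fun 0 p = p.
Proof. by case: p => x y; rewrite /diag_fun !act0. Qed.

Lemma diagD g h p : diag_fun (g + h) p = diag_fun g (diag_fun h p).
Proof. by rewrite /diag_fun !actD. Qed.

Lemma diag_continuous g : continuous (diag_fun g).
Proof.
move=> p; apply: cvg_pair => /=.
- by apply: (cvg_comp _ _ (@cvg_fst _ _ _ _ _)); exact: act_continuous.
- by apply: (cvg_comp _ _ (@cvg_snd _ _ _ _ _)); exact: act_continuous.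
Qed.

Definition diag_action : Zk_action k (X * Y)%type :=
  ZkAction diag0 diagD diag_continuous.

End Maps.

(** The cube [[0,1]^N], used as a type through the coercion [set_type], with the
    topology (and sup metric) induced by ['rV[R]_N]. *)
Definition unit_cube (R : realType) (N : nat) : set 'rV[R]_N :=
  [set v | forall i, 0 <= v ord0 i <= 1].
Arguments unit_cube : clear implicits.

Section Shift.
Variables (R : realType) (k N : nat).

Definition shift_space : Type := {ptws 'rV[int]_k -> unit_cube R N}.

HB.instance Definition _ :=
  Uniform.copy shift_space {ptws 'rV[int]_k -> unit_cube R N}.

Definition shift_fun (m : 'rV[int]_k) (x : shift_space) : shift_space :=
  fun n => x (n + m).

Lemma shift0 x : shift_fun 0 x = x.
Proof. by apply/funext => n; rewrite /shift_fun addr0. Qed.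

Lemma shiftD g h x : shift_fun (g + h) x = shift_fun g (shift_fun h x).
Proof. by apply/funext => n; rewrite /shift_fun addrA. Qed.

Lemma shift_continuous m : continuous (shift_fun m).
Proof.
move=> x.
have F : Filter (shift_fun m y @[y --> x]) by apply: fmap_filter; exact: nbhs_filter.
apply/cvg_sup => n A [B [[C oC <-] Cx CA]].
have Cx' : nbhs (proj (n + m) x) C by exact: open_nbhs_nbhs.
have := @proj_continuous _ (fun _ => unit_cube R N) (n + m) x _ Cx'.
by apply: (@filterS _ _ (nbhs_filter x)) => y; exact: CA.
Qed.

Definition shift_action : Zk_action k shift_space :=
  ZkAction shift0 shiftD shift_continuous.

End Shift.

Definition orbit_map (k : nat) (X : topologicalType) (T : Zk_action k X)
    (R : realType) (N : nat) (f : X -> unit_cube R N) : X -> shift_space R k N :=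
  fun x w => f (T w x).

(** [C(X, Y)] with the topology of uniform convergence. *)
Definition cts_space (X : topologicalType) (Y : uniformType) : Type :=
  initial_topology (fun f : continuousType X Y => f : arrow_uniform_type X Y).

HB.instance Definition _ (X : topologicalType) (Y : uniformType) :=
  Uniform.copy (cts_space X Y)
    (initial_topology (fun f : continuousType X Y => f : arrow_uniform_type X Y)).

HB.instance Definition _ (X : topologicalType) (R : realType)
    (Y : pseudoMetricType R) :=
  PseudoMetric.copy (cts_space X Y)
    (initial_topology (fun f : continuousType X Y => f : arrow_uniform_type X Y)).

Definition cts_space_fun (X : topologicalType) (Y : uniformType)
  (f : cts_space X Y) : X -> Y := (f : continuousType X Y).
Coercion cts_space_fun : cts_space >-> Funclass.

(** ['rV['I_n]_k] enumerates the box [{0, ..., n-1}^k] of [Z^k]. *)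
Definition box_pt (k n : nat) (g : 'rV['I_n]_k) : 'rV[int]_k :=
  map_mx (fun i : 'I_n => (i : nat)%:Z) g.

Section MeanDimension.
Context {R : realType}.
Local Open Scope ereal_scope.

Definition diam (X : Type) (d : X -> X -> R) (A : set X) : \bar R :=
  ereal_sup [set (d x y)%:E | x in A & y in A].

Definition finite_open_cover (X : topologicalType) (U : {fset set X}) :=
  (forall A, A \in U -> open A) /\ \bigcup_(A in [set` U]) A = [set: X].

(** For nonempty [X] the supremum is the maximum of a bounded set of naturals;
    the order is [-oo] on the empty space. *)
Definition cover_order (X : Type) (U : {fset set X}) : \bar R :=
  ereal_sup [set (#|` [fset A in U | x \in A]%fset|%:R)%:E | x in [set: X]] - 1.

(** The infimum of a set of integers bounded below is attained when the set is
    nonempty, which is the case for [X] compact and [d] continuous. *)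
Definition widim (X : topologicalType) (d : X -> X -> R) (e : R) : \bar R :=
  ereal_inf [set cover_order U | U in [set U : {fset set X} |
    finite_open_cover U /\ forall A, A \in U -> diam d A <= e%:E]].

Definition dist_box (k : nat) (X : metricType R) (T : Zk_action k X) (n : nat)
    (x y : X) : R :=
  \big[Num.max/0%R]_(g : 'rV['I_n]_k) mdist (T (box_pt g) x) (T (box_pt g) y).

Definition mdim (k : nat) (X : metricType R) (T : Zk_action k X) : \bar R :=
  ereal_sup [set limn (fun n => widim (dist_box T n) e * ((n%:R ^+ k)^-1)%:E)
            | e in [set e : R | (0 < e)%R]].

End MeanDimension.

Section RokhlinDimension.
Context {k : nat} {R : realType} {Y : metricType R}.
Variable S : Zk_action k Y.

Definition rokhlin_cover (D n : nat) (U : 'I_D.+1 -> set Y) :=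
  [/\ forall i, open (U i),
      forall i, trivIset [set: 'rV['I_n]_k]
                  (fun g => S (box_pt g) @` closure (U i))
    & \bigcup_i \bigcup_(g : 'rV['I_n]_k) (S (box_pt g) @` U i) = [set: Y]].

(** Equal to [+oo] when no [D] is admissible. *)
Definition dim_Rok : \bar R :=
  ereal_inf [set (D%:R)%:E | D in [set D : nat |
    forall n, (0 < n)%N -> exists U : 'I_D.+1 -> set Y, rokhlin_cover n U]].

End RokhlinDimension.

(* Main.v *)
Require Import Defs.
From mathcomp Require Import all_boot all_order all_algebra.
From mathcomp Require Import finmap ring lra.
From mathcomp Require Import all_classical all_reals all_analysis borel_hierarchy.

(** For [e > 0] let [F_e] be the set of those [f] for which two points of one
    fibre of [pi] that are at distance at least [e] are told apart by [f] at
    some point of their orbits ([separates_at]).  The set in question is the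
    intersection of the [F_e] for [e = 1/(n+1)]; by Baire's theorem
    ([baire_of_cauchy], [cts_space_complete]) it is enough that each [F_e] is
    open and dense.  Openness is compactness of [X * X].

    Density ([separates_at_approx]) is where the two dimensions enter.  As
    [mdim T < L/2], for some [n] there is an open cover of [X], with members
    that are small for the metric of the box [{0, ..., n-1}^k], whose
    multiplicity is at most half of [L n^k + 1] ([mdim_small_cover]).  A generic
    map of [X] into the cube [[0,1]^(L n^k)] that factors through the nerve of
    that cover identifies only points of a common member ([generic_map]), and it
    can be chosen close to any given map that is almost constant on the members.
    Split the [(D+1)L] coordinates of [f] into [D+1] blocks [f_i] of size [L].
    The generic map [F_i] is taken close to the box name
    [x |-> (f_i (g x))_(g in box)] of [x].  Let [U_0, ..., U_D] be a Rokhlin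
    cover of [Y] for the box.  Over the disjoint closed sets [g (closure U_i)]
    the block [f_i] is replaced by [x |-> F_i (- g x)_g], and the result is
    extended to [X] close to [f_i] ([glue_on_disjoint_closed]).  Along the orbit
    of a point over [U_i] one then reads off the whole vector [F_i].  As the
    levels [g U_i] cover [Y], for any [x] and [y] in one fibre of [pi] there are
    [i] and [g] with [- g x] and [- g y] both over [U_i]; if their orbits have
    the same values, [F_i] identifies these two points, so [x] and [y] are close.

    The numbers [widim / n^k] must be shown to converge, since [mdim] is defined
    by their limit.  This is Fekete's argument for boxes ([cvg_box_density]); it
    rests on the fact that the order of a common refinement of two covers can be
    bounded by the sum of their orders ([has_cover_join]). *)

Set Implicit Arguments.
Unset Strict Implicit.
Unset Printing Implicit Defensive.

Import Order.TTheory GRing.Theory Num.Theory.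
Import numFieldNormedType.Exports.

Local Open Scope classical_set_scope.
Local Open Scope ring_scope.

(** * Distance functions and partitions of unity *)

Section CappedDistance.
Context {R : realType} {X : metricType R}.
Implicit Type A : set X.

(** Truncation at [1] makes the distance to the empty set meaningful. *)
Definition gap A (x : X) : R := inf ([set 1] `|` [set mdist x y | y in A]).

Lemma has_inf_gap A x : has_inf ([set 1] `|` [set mdist x y | y in A]).
Proof.
split; first by exists 1; left.
by exists 0 => _ [->|[y _ <-]] //; exact: mdist_ge0.
Qed.

Lemma gap_ge0 A x : 0 <= gap A x.
Proof.
apply: lb_le_inf; first by exists 1; left.
by move=> _ [->|[y _ <-]] //; exact: mdist_ge0.
Qed.

Lemma gap_le A x y : A y -> gap A x <= mdist x y.
Proof.
move=> Ay; apply: ge_inf; first by have [] := has_inf_gap A x.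
by right; exists y.
Qed.

Lemma gap0 A x : A x -> gap A x = 0.
Proof.
by move=> Ax; apply/eqP; rewrite eq_le gap_ge0 andbT -(mdistxx x) gap_le.
Qed.

Lemma gap_gt0 A x : closed A -> ~ A x -> 0 < gap A x.
Proof.
move=> cA nAx.
have : nbhs x (~` A) by apply: open_nbhs_nbhs; split => //; exact: closed_openC.
rewrite -metricType_numDomainType.filter_from_mdist_nbhs => -[e e0 eA].
have e0' : 0 < Num.min 1 e by rewrite lt_min ltr01.
apply: (lt_le_trans e0'); apply: lb_le_inf; first by exists 1; left.
move=> _ [->|[y Ay <-]]; first by rewrite ge_min lexx.
rewrite ge_min; apply/orP; right; rewrite leNgt; apply/negP => /eA; exact.
Qed.

Lemma gap_lipschitz A x y : gap A x <= mdist x y + gap A y.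
Proof.
rewrite -lerBlDl; apply: lb_le_inf; first by exists 1; left.
have [_ lbx] := has_inf_gap A x.
move=> _ [->|[z Az <-]]; rewrite lerBlDl.
  apply: (@le_trans _ _ 1); last by rewrite lerDr mdist_ge0.
  by apply: ge_inf => //; left.
exact: (le_trans (gap_le _ Az) (metric_triangle _ _ _)).
Qed.

Lemma gap_continuous A : continuous (gap A).
Proof.
move=> x; apply/cvgrPdist_le => e e0; near=> y.
have xy : mdist x y <= e.
  by apply: ltW; near: y; apply: (metricType_numDomainType.cvgr_dist_lt (f := id)).
rewrite ler_norml; apply/andP; split.
  have := gap_lipschitz A y x; rewrite metric_sym; lra.
have := gap_lipschitz A x y; lra.
Unshelve. all: by end_near. Qed.

End CappedDistance.

Section PartitionOfUnity.
Context {R : realType} {X : metricType R}.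

Lemma continuous_sum (I : Type) (s : seq I) (P : pred I) (h : I -> X -> R) :
  (forall i, continuous (h i)) -> continuous (fun x => \sum_(i <- s | P i) h i x).
Proof.
move=> ch; elim: s => [|i s IH].
  by under eq_fun do rewrite big_nil; exact: cst_continuous.
under eq_fun do rewrite big_cons.
by case: (P i) => // x; apply: cvgD; [exact: ch|exact: IH].
Qed.

(** The weights are the normalised distances to the complements, so that the
    support of [phi i] is exactly [U i]: a positive weight certifies membership
    and membership forces a positive weight. *)
Lemma partition_of_unity (I : finType) (U : I -> set X) :
  (forall i, open (U i)) -> (forall x, exists i, U i x) ->
  exists phi : I -> X -> R,
    [/\ forall i, continuous (phi i), forall i x, 0 <= phi i x,
        forall i x, (phi i x != 0) = (x \in U i)
      & forall x, \sum_i phi i x = 1].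
Proof.
move=> oU covU; pose g i := gap (~` U i).
have g_gt0 i x : U i x -> 0 < g i x.
  by move=> Ux; apply: gap_gt0; [exact: open_closedC|rewrite /setC/= => /(_ Ux)].
have g_eq0 i x : ~ U i x -> g i x = 0 by move=> nUx; exact: gap0.
pose G x := \sum_i g i x.
have G_gt0 x : 0 < G x.
  have [i Ux] := covU x; rewrite /G (bigD1 i)//= ltr_wpDr ?g_gt0//.
  by apply: sumr_ge0 => j _; exact: gap_ge0.
have cG : continuous G by apply: continuous_sum => i; exact: gap_continuous.
exists (fun i x => g i x / G x); split.
- move=> i x; apply: cvgM; first exact: gap_continuous.
  by apply: cvgV; [rewrite gt_eqF|exact: cG].
- by move=> i x; rewrite divr_ge0 ?gap_ge0// ltW.
- move=> i x; rewrite mulf_eq0 invr_eq0 (gt_eqF (G_gt0 x)) orbF.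
  apply/idP/idP; last by rewrite inE => /g_gt0 /gt_eqF ->.
  by apply: contraNT; rewrite notin_setE => /g_eq0 ->.
- by move=> x; rewrite -mulr_suml divff// gt_eqF// G_gt0.
Qed.

(** As in Urysohn's lemma, [u i] compares the distance to [A i] with the distance
    to the union of the other sets, which is closed and disjoint from [A i]. *)
Lemma separating_functions (I : finType) (A : I -> set X) :
  (forall i, closed (A i)) -> trivIset [set: I] A ->
  exists u : I -> X -> R,
    [/\ forall i, continuous (u i), forall i x, A i x -> u i x = 1
      & forall i j x, j != i -> A j x -> u i x = 0].
Proof.
move=> cA tA; pose B i := \bigcup_(j in [set j | j != i]) A j.
have cB i : closed (B i).
  apply: closed_bigcup => [|j _]; [exact: finite_finset|exact: cA].
have dAB i x : 0 < gap (A i) x + gap (B i) x.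
  have [Bx|nBx] := pselect (B i x); last first.
    by rewrite ltr_wpDl ?gap_ge0 ?gap_gt0.
  rewrite ltr_wpDr ?gap_ge0 ?gap_gt0// => Ax.
  case: Bx => j /= ji Ajx; suff : j = i by move/eqP; rewrite (negbTE ji).
  by apply: tA => //; exists x.
exists (fun i x => gap (B i) x / (gap (A i) x + gap (B i) x)); split.
- move=> i x; apply: cvgM; first exact: gap_continuous.
  apply: cvgV; first by rewrite gt_eqF.
  by apply: cvgD; exact: gap_continuous.
- move=> i x Ax; have := dAB i x; rewrite (gap0 Ax) add0r => h.
  by rewrite divff ?gt_eqF.
- by move=> i j x ji Ax; rewrite (@gap0 _ _ (B i)) ?mul0r//; exists j.
Qed.

(** Heine-Cantor. *)
Lemma uniform_modulus (f : X -> R) (e : R) : compact [set: X] -> continuous f ->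
  0 < e ->
  exists2 r : R, 0 < r & forall x y, mdist x y <= r -> `|f x - f y| <= e.
Proof.
move=> cX cf e0.
have e20 : 0 < e / 2 by rewrite divr_gt0.
have /compact_near_coveringP/(_ R (0^'+)
  (fun r x => forall y, mdist x y <= r -> `|f x - f y| <= e)) := cX.
case=> [|r r0 rP].
  move=> x _.
  have [d d0 dP] : exists2 d, 0 < d &
      forall y, mdist x y < d -> `|f x - f y| <= e / 2.
    have /cvgrPdist_le/(_ _ e20) := cf x.
    by rewrite /= => /metricType_numDomainType.nbhs_mdistP.
  have d20 : 0 < d / 2 by rewrite divr_gt0.
  exists ([set x' | mdist x x' < d / 2], [set r | r < d / 2]) => /=.
    split.
      by apply: (metricType_numDomainType.cvgr_dist_lt (f := id)).
    by apply: nbhs_right_lt.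
  move=> [x' r] /= [xx' rd] y x'y.
  have -> : f x' - f y = (f x - f y) - (f x - f x') by lra.
  apply: (le_trans (ler_normB _ _)); rewrite [e]splitr lerD// dP//; last lra.
  by apply: (le_lt_trans (metric_triangle x x' y)); lra.
have r20 : 0 < r / 2 by rewrite divr_gt0.
have rr : r / 2 < r by rewrite ltr_pdivrMr// ltr_pMr// ltr1n.
exists (r / 2) => // x y xy; apply: (rP (r / 2)) => //=.
by rewrite sub0r normrN gtr0_norm.
Qed.

End PartitionOfUnity.

(** * General position *)


Section GeneralPosition.
Context {R : realType}.

Lemma convex_comb01 (t a b : R) : 0 <= t <= 1 -> 0 <= a <= 1 -> 0 <= b <= 1 ->
  0 <= (1 - t) * a + t * b <= 1.
Proof.
move=> /andP[t0 t1] /andP[a0 a1] /andP[b0 b1]; apply/andP; split; nra.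
Qed.

Lemma dist01_le1 (a b : R) : 0 <= a <= 1 -> 0 <= b <= 1 -> `|a - b| <= 1.
Proof.
move=> /andP[a0 a1] /andP[b0 b1]; rewrite ler_norml; apply/andP; split; lra.
Qed.

Lemma nonroot_near0 (p : {poly R}) (e : R) : p != 0 -> 0 < e ->
  exists2 t, 0 < t <= e & ~~ root p t.
Proof.
move=> p0 e0; pose t (n : nat) : R := e / n.+1%:R.
have t_inj : injective t.
  have /negbT e_neq0 := gt_eqF e0.
  by move=> m n /(mulfI e_neq0) /invr_inj /eqP; rewrite eqr_nat eqSS => /eqP.
have [/(max_poly_roots p0)|/allPn[_ /mapP[n _ ->] nroot]] :=
    boolP (all (root p) (map t (iota 0 (size p)))).
  by rewrite map_inj_uniq// iota_uniq size_map size_iota ltnn => /(_ isT).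
exists (t n) => //; rewrite divr_gt0//= ler_pdivrMr//.
by rewrite -{1}[e]mulr1 ler_pM2l// ler1n.
Qed.

(** The last clause says that any [#|J| + 1] of the points [p i] are affinely
    independent, which holds as soon as a maximal minor of each matrix formed by
    at most [#|J| + 1] rows [(1, p i)] is nonzero.  The [p i] are taken on the
    segments from [q i] to points [v i] of the moment curve, at a common parameter
    [t].  Each minor is a polynomial in [t] whose value at [t = 1] is a nonzero
    Vandermonde determinant; hence all small [t > 0] but finitely many work. *)
Lemma general_position (J I : finType) (q : I -> J -> R) (e : R) :
  0 < e -> (forall i j, 0 <= q i j <= 1) ->
  exists p : I -> J -> R,
    [/\ forall i j, 0 <= p i j <= 1, forall i j, `|p i j - q i j| <= e
      & forall c : I -> R, (#|[set i | c i != 0%R]%SET| <= #|J|.+1)%N ->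
          \sum_i c i = 0 -> (forall j, \sum_i c i * p i j = 0) ->
          forall i, c i = 0].
Proof.
move=> e0 q01.
(* Distinct parameters in [0, 1] on the moment curve. *)
pose s (i : I) : R := (enum_rank i)%:R / #|I|%:R.
have I_gt0 (i : I) : 0 < #|I|%:R :> R by rewrite ltr0n; apply/card_gt0P; exists i.
have s_inj : injective s.
  move=> i i'; rewrite /s => /(mulIf _) /=.
  rewrite invr_eq0 (gt_eqF (I_gt0 i)) => /(_ isT) /eqP.
  by rewrite eqr_nat => /eqP /ord_inj /enum_rank_inj.
have s01 i : 0 <= s i <= 1.
  rewrite divr_ge0//= ler_pdivrMr ?I_gt0// mul1r ler_nat.
  exact/ltnW/ltn_ord.
pose v (i : I) (j : J) : R := s i ^+ (enum_rank j).+1.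
have v01 i j : 0 <= v i j <= 1.
  by case/andP: (s01 i) => s0 s1; rewrite exprn_ge0//= exprn_ile1.
pose P (i : I) (j : J) : {poly R} := (1 - 'X) * (q i j)%:P + 'X * (v i j)%:P.
(* The column [0] is the constant coordinate of the homogenised points. *)
pose colP (b : 'I_#|J|.+1) (i : I) : {poly R} :=
  oapp (fun b' => P i (enum_val b')) 1 (unlift ord0 b).
pose M (B : {set I}) : 'M[{poly R}]_(#|B|) :=
  \matrix_(a, b) colP (inord b) (enum_val a).
pose D := \prod_(B : {set I} | (#|B| <= #|J|.+1)%N) \det (M B).
have hornerM (B : {set I}) t :
    (\det (M B)).[t] = \det (map_mx (horner_eval t) (M B)).
  by rewrite det_map_mx.
have D_neq0 : D != 0.
  apply/negP => /eqP D0; have : D.[1] = 0 by rewrite D0 horner0.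
  rewrite /D horner_prod => /eqP; apply/negP; apply/prodf_neq0 => B cB.
  rewrite hornerM.
  have -> : map_mx (horner_eval 1) (M B) =
      (Vandermonde #|B| (\row_a s (enum_val a)))^T.
    apply/matrixP => a b; rewrite !mxE /colP /horner_eval.
    have bJ : (b < #|J|.+1)%N := leq_trans (ltn_ord b) cB.
    case: unliftP => [b' bE|bE] /=; have := congr1 val bE; rewrite /= inordK//.
      rewrite /bump /= add1n => ->.
      by rewrite !hornerE subrr mul0r add0r ?mul1r /v enum_valK.
    by move=> ->; rewrite hornerE expr0.
  rewrite det_tr det_Vandermonde; apply/prodf_neq0 => a _.
  apply/prodf_neq0 => b ab; rewrite !mxE subr_eq0.
  by apply: contraTneq ab => /s_inj /enum_val_inj ->; rewrite ltnn.
have e1 : 0 < Num.min 1 e by rewrite lt_min ltr01.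
have [t /andP[t0]] := nonroot_near0 D_neq0 e1.
rewrite le_min => /andP[t1 te] nroot.
have PE i j : (P i j).[t] = (1 - t) * q i j + t * v i j by rewrite !hornerE.
exists (fun i j => (P i j).[t]); split.
- by move=> i j; rewrite PE; apply: convex_comb01; rewrite // (ltW t0).
- move=> i j; rewrite PE.
  have -> : (1 - t) * q i j + t * v i j - q i j = t * (v i j - q i j) by ring.
  by rewrite normrM (gtr0_norm t0) -[e]mulr1 ler_pM ?dist01_le1// ltW.
- move=> c; set B := [set i | c i != 0]%SET => cB sum0 sumP.
  have uM : map_mx (horner_eval t) (M B) \in unitmx.
    rewrite unitmxE unitfE -hornerM; move: nroot; rewrite rootE horner_prod.
    by move=> /prodf_neq0 /(_ B cB).
  pose w : 'rV[R]_#|B| := \row_a c (enum_val a).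
  have /(congr1 (mulmx^~ (invmx (map_mx (horner_eval t) (M B))))) :
      w *m map_mx (horner_eval t) (M B) = 0.
    apply/rowP => b; rewrite !mxE.
    under eq_bigr do rewrite !mxE.
    rewrite -(big_enum_val (A := mem B) (fun i => c i * (colP (inord b) i).[t])) /=.
    rewrite big_mkcond /= (eq_bigr (fun i => c i * (colP (inord b) i).[t]));
      last by move=> i _; rewrite inE; case: eqP => //= ->; rewrite mul0r.
    rewrite /colP; case: unliftP => [b' _|_] /=; first exact: sumP.
    by under eq_bigr do rewrite hornerE mulr1.
  rewrite mulmxK// mul0mx => w0 i; apply/eqP; apply: contraT => ci.
  have iB : i \in B by rewrite inE.
  have := congr1 (fun w : 'rV[R]_#|B| => w ord0 (enum_rank_in iB i)) w0.
  by rewrite !mxE enum_rankK_in// => ci0; rewrite ci0 eqxx in ci.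
Qed.

End GeneralPosition.

Section GenericMap.
Context {R : realType} {X : metricType R}.

(** [F x] is the barycentre of points [p i] in general position, weighted by a
    partition of unity.  If [F x = F y], the difference of the weights of [x] and
    [y] is an affine relation between at most [2 m + 2 <= #|J| + 1] of the [p i],
    hence trivial: [x] and [y] have the same weights and lie in the same members
    of the cover.  Taking [p i] near the values of [f] on [U i] makes [F] close to
    [f]. *)
Lemma generic_map (I J : finType) (U : I -> set X) (f : J -> X -> R) (m : nat)
    (e : R) :
  (forall i, open (U i)) -> (forall x, exists i, U i x) ->
  (forall x, (#|[set i | x \in U i]%SET| <= m.+1)%N) -> (m.*2 < #|J|)%N ->
  0 < e -> (forall j, continuous (f j)) -> (forall j x, 0 <= f j x <= 1) ->
  (forall i j x y, U i x -> U i y -> `|f j x - f j y| <= e / 2) ->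
  exists F : J -> X -> R,
    [/\ forall j, continuous (F j), forall j x, 0 <= F j x <= 1,
        forall j x, `|F j x - f j x| <= e
      & forall x y, (forall j, F j x = F j y) -> exists2 i, U i x & U i y].
Proof.
move=> oU covU multU mJ e0 cf f01 oscf.
have e20 : 0 < e / 2 by rewrite divr_gt0.
have /choice[q qP] (i : I) : exists r : J -> R,
    (forall j, 0 <= r j <= 1) /\ forall j x, U i x -> `|r j - f j x| <= e / 2.
  have [[x Ux]|U0] := pselect (exists x, U i x).
    by exists (f^~ x); split=> // j y Uy; exact: oscf Ux Uy.
  exists (fun=> 0); split=> [j|j x Ux]; first by rewrite lexx ler01.
  by case: U0; exists x.
have [p [p01 pq genp]] := general_position e20 (fun i => (qP i).1).
have [phi [cphi phi0 phiU sum_phi]] := partition_of_unity oU covU.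
have phi_eq0 i x : ~ U i x -> phi i x = 0.
  by move=> nUx; apply/eqP; rewrite -[_ == _]negbK phiU notin_setE.
have FB (a : X -> R) j x : \sum_i phi i x * p i j - a x =
    \sum_i phi i x * (p i j - a x).
  rewrite -[a x in LHS]mul1r -(sum_phi x) mulr_suml -sumrB.
  by apply: eq_bigr => i _; rewrite mulrBr.
exists (fun j x => \sum_i phi i x * p i j); split.
- move=> j; apply: continuous_sum => i x.
  by apply: cvgM; [exact: cphi|exact: cvg_cst].
- move=> j x; apply/andP; split.
    by apply: sumr_ge0 => i _; rewrite mulr_ge0//; case/andP: (p01 i j).
  rewrite -(sum_phi x); apply: ler_sum => i _.
  by rewrite -[leRHS]mulr1 ler_wpM2l//; case/andP: (p01 i j).
- move=> j x; rewrite FB; apply: (le_trans (ler_norm_sum _ _ _)).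
  rewrite -[e]mul1r -(sum_phi x) mulr_suml; apply: ler_sum => i _.
  have [Ux|/phi_eq0 ->] := pselect (U i x); last by rewrite !mul0r normr0.
  rewrite normrM ger0_norm// ler_wpM2l//.
  have -> : p i j - f j x = (p i j - q i j) + (q i j - f j x).
    by rewrite addrA subrK.
  apply: (le_trans (ler_normD _ _)).
  by rewrite [e]splitr lerD ?pq//; exact: (qP i).2.
- move=> x y Fxy.
  have /= phi_xy := genp (fun i => phi i x - phi i y).
  have {}phi_xy i : phi i x = phi i y.
    apply/eqP; rewrite -subr_eq0; apply/eqP/phi_xy.
    + apply: (@leq_trans (m.+1 + m.+1)); last first.
        by rewrite addSn addnS addnn ltnS.
      apply: (leq_trans _ (leq_add (multU x) (multU y))).
      apply: (leq_trans _ (leq_card_setU _ _)).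
      apply/subset_leq_card/fintype.subsetP => j; rewrite !inE; apply: contraR.
      rewrite negb_or => /andP[].
      by rewrite -2!phiU !negbK => /eqP -> /eqP ->; rewrite subrr.
    + by rewrite sumrB !sum_phi subrr.
    + move=> j; under eq_bigr do rewrite mulrBl.
      by rewrite sumrB (Fxy j) subrr.
  have [i phix] : exists i, phi i x != 0.
    apply: contrapT => /forallNP h; have := sum_phi x.
    rewrite big1 => [/esym/eqP|i _]; first by rewrite oner_eq0.
    by apply/eqP; have /negP := h i; rewrite negbK.
  exists i; apply: set_mem; rewrite -phiU//.
  by rewrite -phi_xy.
Qed.

End GenericMap.

(** * Covers of small order *)

Section Covers.
Context {R : realType}.

(** Covers of order at most [m].  They are indexed by a finite type, rather than
    being finite sets of sets, so that a refinement may repeat members. *)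
Definition has_cover (X : topologicalType) (P : set (set X)) (m : nat) :=
  exists (I : finType) (U : I -> set X),
    [/\ forall i, open (U i), forall i, P (U i), forall x, exists i, U i x
      & forall x, (#|[set i | x \in U i]%SET| <= m.+1)%N].

Definition hereditary (X : Type) (P : set (set X)) :=
  P set0 /\ forall A B, A `<=` B -> P B -> P A.

(** Given a partition of unity for the cover of order [m], the family of colour [c]
    sorts the points by the set [S] of indices whose weight exceeds a threshold
    [t c]; a point is missed only if some weight equals [t c].  As the thresholds
    are distinct and positive, a point is missed by at most as many colours as it
    has nonzero weights, of which there are at most [m + 1].  If it were missed by
    [m + 1] colours, the sum of its weights would be a sum of thresholds, and
    these are so small that they add up to less than [1]. *)
Lemma staggered_families (X : metricType R) (P : set (set X)) (m N : nat) :
  hereditary P -> has_cover P m ->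
  exists (I : finType) (W : 'I_N -> I -> set X),
    [/\ forall c i, open (W c i), forall c i, P (W c i),
        forall c i j x, W c i x -> W c j x -> i = j
      & forall x, (#|[set c | x \notin (\bigcup_i W c i)%classic]%SET| <= m)%N].
Proof.
move=> [P0 hP] [I [U [oU PU covU multU]]].
have [phi [cphi phi0 phiU sum_phi]] := partition_of_unity oU covU.
(* [K] is such that [N] thresholds, or [#|I|] copies of one, sum to less than 1. *)
pose K := (N * (N + #|I|)).+1.
pose t (c : 'I_N) : R := c.+1%:R / K%:R.
have K0 : 0 < K%:R :> R by rewrite ltr0n.
have t_gt0 c : 0 < t c by rewrite divr_gt0// ltr0n.
have t_inj : injective t.
  move=> c c' /(mulIf _); rewrite invr_eq0 (gt_eqF K0) => /(_ isT) /eqP.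
  by rewrite eqr_nat eqSS => /eqP /ord_inj.
have t_le c : t c <= N%:R / K%:R by rewrite ler_pM2r ?invr_gt0// ler_nat.
have sum_t (A : {set 'I_N}) : \sum_(c in A) t c < 1.
  apply: (@le_lt_trans _ _ (\sum_(c : 'I_N) N%:R / K%:R)).
    rewrite big_mkcond; apply: ler_sum => c _; case: ifP => _.
      exact: t_le.
    by rewrite divr_ge0.
  rewrite sumr_const card_ord -[_ *+ N]mulr_natr mulrAC ltr_pdivrMr//.
  by rewrite mul1r -natrM ltr_nat ltnS leq_mul2l leq_addr orbT.
pose W c (S : {set I}) := [set x | S != finset.set0 /\
  forall i, if i \in S then t c < phi i x else phi i x < t c].
have WU c S x : W c S x -> exists i, W c S `<=` U i.
  move=> [/set0Pn[i iS] _]; exists i => y [_ /(_ i)]; rewrite iS => ty.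
  by apply: set_mem; rewrite -phiU gt_eqF// (lt_trans (t_gt0 c)).
exists {set I}, W; split.
- move=> c S; rewrite openE => x [S0 SP].
  suff : \forall y \near x, forall i,
      if i \in S then t c < phi i y else phi i y < t c.
    by apply: filterS.
  apply: filter_forall => i; have := SP i; have cp := cphi i x.
  by case: (i \in S) => h; [apply: (cvgr_gt _ cp)|apply: (cvgr_lt _ cp)].
- move=> c S; have [[x /WU[i WUi]]|W0] := pselect (W c S !=set0).
    exact: hP WUi (PU i).
  suff -> : W c S = set0 by [].
  by apply/seteqP; split=> // x Wx; apply: W0; exists x.
- move=> c S S' x [_ Sx] [_ S'x]; apply/finset.setP => i.
  move: (Sx i) (S'x i); case: (i \in S); case: (i \in S') => // h /(lt_trans h);
  by rewrite ltxx.
- move=> x; set Miss := [set c | _]%SET.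
  have missed c : exists i, c \in Miss -> phi i x = t c.
    have [i0 _] := covU x.
    have [//|nex] := pselect (exists i, c \in Miss -> phi i x = t c).
    have {}nex i : c \in Miss /\ phi i x != t c.
      by move/forallNP/(_ i): nex => /not_implyP[cM /eqP].
    have [] := nex i0; rewrite inE notin_setE => /forall2NP nW _.
    have [[]//|WN] := nW [set i | t c < phi i x]%SET; exfalso; apply: WN.
    split=> [|i]; last first.
      rewrite inE; case: ltP => // pt; rewrite lt_neqAle pt andbT.
      by have [] := nex i.
    (* No weight above the threshold: the weights could not sum to 1. *)
    apply/negP => /eqP S0.
    have : \sum_i phi i x <= \sum_(i : I) N%:R / K%:R.
      apply: ler_sum => i _; apply: (le_trans _ (t_le c)); rewrite leNgt.
      apply/negP => ti; have : i \in [set i | t c < phi i x]%SET by rewrite inE.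
      by rewrite S0 inE.
    rewrite sum_phi sumr_const -[_ *+ _]mulr_natr mulrAC leNgt ltr_pdivrMr//.
    by rewrite mul1r -natrM ltr_nat ltnS leq_mul2l leq_addl orbT.
  have /choice[g gP] := missed.
  have g_inj : {in Miss &, injective g}.
    by move=> c c' cM c'M gcc'; apply: t_inj; rewrite -!gP// gcc'.
  have gsub : (g @: Miss \subset [set i | x \in U i])%SET.
    apply/fintype.subsetP => _ /imsetP[c cM ->].
    by rewrite inE -phiU gP// gt_eqF.
  rewrite leqNgt; apply/negP => mM.
  have /eqP gE : (g @: Miss == [set i | x \in U i])%SET.
    by rewrite finset.eqEcard gsub card_in_imset// (leq_trans (multU x)).
  have := sum_t Miss; apply/negP; rewrite -leNgt -(sum_phi x).
  rewrite [leLHS](bigID (mem (g @: Miss))) /=.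
  rewrite [X in _ + X]big1 ?addr0 => [|i]; last first.
    by rewrite gE inE -phiU negbK => /eqP.
  rewrite big_imset//= (eq_bigr t)// => c; exact: gP.
Qed.

(** Take [m + l + 1] colours for both covers.  At most [m] of them miss a point for
    the first cover and at most [l] for the second, so some colour [c] misses it
    for neither.  Hence the intersections of equally coloured members cover, and
    a point lies in at most one of each colour. *)
Lemma has_cover_join (X : metricType R) (P Q : set (set X)) (m l : nat) :
  hereditary P -> hereditary Q -> has_cover P m -> has_cover Q l ->
  has_cover (P `&` Q) (m + l).
Proof.
move=> hP hQ cP cQ.
have [I [W [oW PW dW mW]]] := staggered_families (m + l).+1 hP cP.
have [K [V [oV QV dV mV]]] := staggered_families (m + l).+1 hQ cQ.
exists ('I_(m + l).+1 * (I * K))%type, (fun z => W z.1 z.2.1 `&` V z.1 z.2.2).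
split.
- by move=> z; exact: openI.
- move=> z; split; first by apply: (hP.2 _ _ _ (PW z.1 z.2.1)) => x [].
  by apply: (hQ.2 _ _ _ (QV z.1 z.2.2)) => x [].
- move=> x.
  set A := [set c | x \notin (\bigcup_i W c i)%classic]%SET.
  set B := [set c | x \notin (\bigcup_i V c i)%classic]%SET.
  have [c] : exists c, c \notin (A :|: B)%SET.
    apply/existsP; rewrite -negb_forall; apply/negP => /forallP AB.
    have : (#|(A :|: B)%SET| <= m + l)%N.
      exact: (leq_trans (leq_card_setU _ _) (leq_add (mW x) (mV x))).
    rewrite -ltnS -[X in (_ < X)%N]card_ord -cardsT ltnNge subset_leq_card//.
    by apply/fintype.subsetP.
  rewrite finset.in_setU negb_or !inE !negbK.
  move=> /andP[/set_mem[i _ Wx] /set_mem[j _ Vx]].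
  by exists (c, (i, j)).
- move=> x; set A := [set z | _]%SET.
  suff fst_inj : {in A &, injective fst}.
    by rewrite -(card_in_imset fst_inj) -[X in (_ <= X)%N]card_ord max_card.
  move=> [c [i k]] [c' [i' k']]; rewrite !inE /= => -[Wx Vx] [Wx' Vx'] cc'.
  by subst c'; rewrite (dW _ _ _ _ Wx Wx') (dV _ _ _ _ Vx Vx').
Qed.

End Covers.

(** * Widim of boxes *)

Section Widim.
Context {R : realType}.

Lemma widim_le (X : topologicalType) (d : X -> X -> R) (e : R) (m : nat) :
  has_cover [set A | (diam d A <= e%:E)%E] m -> (widim d e <= m%:R%:E)%E.
Proof.
move=> [I [U [oU PU covU multU]]].
pose V : {fset set X} := [fset U i | i in I]%fset.
apply: (@le_trans _ _ (cover_order V)); last first.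
  rewrite /cover_order leeBlDr//.
  have -> : (m%:R%:E + 1 = m.+1%:R%:E :> \bar R)%E by rewrite -natr1.
  apply: ge_ereal_sup => _ [x _ <-]; rewrite lee_fin ler_nat.
  apply: (leq_trans _ (multU x)).
  have sub : ([fset A in V | x \in A] `<=`
      [fset U i | i in [set i | x \in U i]%SET])%fset.
    apply/fsubsetP => A; rewrite !inE /= => /andP[/imfsetP[i _ ->] xU].
    by apply/imfsetP; exists i; rewrite //= inE.
  apply: (leq_trans (fsubset_leq_card sub)).
  by apply: (leq_trans (leq_imfset_card _ _ _)); rewrite cardE.
apply: ereal_inf_lbound; exists V => //; split.
  split; first by move=> A /imfsetP[i _ ->].
  apply/seteqP; split=> // x _; have [i Ux] := covU x.
  by exists (U i) => //=; apply/imfsetP; exists i.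
by move=> A /imfsetP[i _ ->]; exact: PU.
Qed.

(** The order of a cover is a natural number, so a strict bound by [m + 1] already
    gives a cover of order [m]. *)
Lemma widim_lt (X : topologicalType) (d : X -> X -> R) (e : R) (m : nat) :
  (widim d e < m.+1%:R%:E)%E -> has_cover [set A | (diam d A <= e%:E)%E] m.
Proof.
move=> /ereal_inf_lt[_ [U [[oU covU] PU] <-] ordU].
exists U, (fun A => val A); split.
- by move=> A; apply/oU/valP.
- by move=> A; apply/PU/valP.
- move=> x; have : setT x by []. 
  by rewrite -covU => -[A AU Ax]; exists [` AU]%fset.
- move=> x.
  have card_lt : (#|` [fset A in U | x \in A]%fset| <= m.+1)%N.
    rewrite -ltnS -(ltr_nat R) -lte_fin -natr1 EFinD -lteBlDr//.
    apply: le_lt_trans ordU; rewrite leeB//; apply: ereal_sup_ubound.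
    by exists x.
  apply: leq_trans card_lt.
  rewrite cardE -(size_map val).
  apply: uniq_leq_size.
    by rewrite map_inj_uniq ?enum_uniq//; exact: val_inj.
  move=> _ /mapP[A + ->]; rewrite mem_enum !inE /= => Ax.
  by apply/andP; split; [exact: (valP A)|exact: mem_set].
Qed.

Lemma widim_ge0 (X : topologicalType) (d : X -> X -> R) (e : R) (x : X) :
  (0 <= widim d e)%E.
Proof.
apply: le_ereal_inf_tmp => _ [U [[oU covU] PU] <-].
rewrite /cover_order leeBrDr// add0e.
apply: (@le_trans _ _ (#|` [fset A in U | x \in A]%fset|%:R%:E)).
  have : setT x by [].
  rewrite -covU => -[A AU Ax]; rewrite lee_fin ler1n cardfs_gt0.
  by apply/fset0Pn; exists A; rewrite !inE /= (mem_set Ax) andbT.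
by apply: ereal_sup_ubound; exists x.
Qed.

End Widim.

Section Growth.
Context {R : realType} {k : nat} {X : metricType R} (T : Zk_action k X) (e : R).

Definition orbit_small (G : Type) (h : G -> 'rV[int]_k) : set (set X) :=
  [set A | forall g x y, A x -> A y -> mdist (T (h g) x) (T (h g) y) <= e].

Lemma hereditary_orbit_small (G : Type) (h : G -> 'rV[int]_k) :
  hereditary (orbit_small h).
Proof. by split=> [|A B AB BP] g x y // /AB Bx /AB; exact: BP. Qed.

Lemma diam_dist_box n : 0 <= e ->
  [set A | (diam (dist_box T n) A <= e%:E)%E] = orbit_small (@box_pt k n).
Proof.
move=> e0; apply/seteqP; split => [A dA g x y Ax Ay|A sA] /=.
  rewrite -lee_fin; apply: le_trans dA.
  apply: (@le_trans _ _ (dist_box T n x y)%:E).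
    by rewrite lee_fin; exact: le_bigmax.
  by apply: ereal_sup_ubound; exists x => //; exists y.
apply: ge_ereal_sup => _ [x Ax [y Ay <-]]; rewrite lee_fin.
by apply: bigmax_le => // g _; exact: sA.
Qed.

Lemma has_cover_translate (G : Type) (h : G -> 'rV[int]_k) v m :
  has_cover (orbit_small h) m -> has_cover (orbit_small (fun g => h g + v)) m.
Proof.
move=> [I [U [oU sU covU multU]]]; exists I, (fun i => T v @^-1` U i); split.
- by move=> i; move/continuousP : (@act_continuous _ _ T v); apply; exact: oU.
- by move=> i g x y Ux Uy; rewrite !actD; exact: (sU i g _ _ Ux Uy).
- by move=> x; exact: covU.
- move=> x; apply: leq_trans (multU (T v x)); apply/subset_leq_card.
  by apply/fintype.subsetP => i; rewrite !inE.
Qed.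

(** The box of side [N] is covered by [q ^ k] translates of the box of side [n],
    and the order is subadditive ([has_cover_join]) and invariant under translation
    ([has_cover_translate]). *)
Lemma has_cover_box (n q N m : nat) : (0 < n)%N -> (N <= q * n)%N ->
  has_cover (orbit_small (@box_pt k n)) m ->
  has_cover (orbit_small (@box_pt k N)) (q ^ k * m).
Proof.
move=> n0 Nqn cn.
pose P (h : 'rV['I_q]_k) := orbit_small (fun g : 'rV['I_n]_k =>
  box_pt g + box_pt h *+ n).
have cP (s : seq 'rV['I_q]_k) :
    has_cover [set A | forall h, h \in s -> P h A] (size s * m).
  elim: s => [|h s IH].
    exists unit, (fun=> setT); split=> [_|_ h //|x|x]; first exact: openT.
      by exists tt.
    by rewrite (leq_trans (max_card _))// card_unit.
  rewrite /= mulSn.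
  have -> : [set A | forall h', h' \in h :: s -> P h' A] =
      P h `&` [set A | forall h', h' \in s -> P h' A].
    apply/seteqP; split => A.
      move=> hA; split; first by apply: hA; rewrite mem_head.
      by move=> h' h's; apply: hA; rewrite inE h's orbT.
    by move=> [hA sA] h'; rewrite inE => /predU1P[->|/sA].
  apply: has_cover_join => //; first exact: hereditary_orbit_small.
    split=> [h' _|A B AB BP h' h's]; first exact: (hereditary_orbit_small _).1.
    exact: (hereditary_orbit_small _).2 AB (BP _ h's).
  exact: has_cover_translate.
have [I [U [oU PU covU multU]]] := cP (enum {: 'rV['I_q]_k}).
exists I, U; split=> //; last first.
  by move=> x; rewrite (leq_trans (multU x))// -cardE card_mx card_ord mul1n.
move=> i b x y Ux Uy.
(* Coordinatewise Euclidean division by [n] locates [b] in a translate. *)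
have bq (j : 'I_k) : (b ord0 j %/ n < q)%N.
  by rewrite ltn_divLR// (leq_trans (ltn_ord _)).
have bn (j : 'I_k) : (b ord0 j %% n < n)%N by rewrite ltn_mod.
have bE : box_pt b =
    box_pt (\row_j Ordinal (bn j)) + box_pt (\row_j Ordinal (bq j)) *+ n.
  apply/rowP => j; rewrite !mxE mulmxnE !mxE /=.
  by rewrite pmulrn mulrzz -PoszM -PoszD addnC -divn_eq.
rewrite bE; apply: (PU i (\row_j Ordinal (bq j))) => //.
by rewrite mem_enum.
Qed.

(** Small balls give a cover for the box of side [1], and [has_cover_box] passes
    from it to the other boxes. *)
Lemma exists_cover_box n : compact [set: X] -> 0 < e ->
  exists m, has_cover (orbit_small (@box_pt k n)) m.
Proof.
move=> cX e0.
have e20 : 0 < e / 2 by rewrite divr_gt0.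
(* The filter of large finite sets of centres of balls. *)
pose F : set_system {fset X} :=
  filter_from setT (fun D0 => [set D | (D0 `<=` D)%fset]).
have [||D0 _ covD] := (compact_near_coveringP _).1 cX _ F
    (fun D x => exists2 y : X, y \in D & (ball y (e / 2))° x).
- apply: filter_fromT_filter; first by exists fset0.
  move=> D1 D2; exists (D1 `|` D2)%fset => D /= sD; split.
    exact: fsubset_trans (fsubsetUl _ _) sD.
  exact: fsubset_trans (fsubsetUr _ _) sD.
- move=> x _; exists ((ball x (e / 2))°, [set D | ([fset x] `<=` D)%fset]).
    split; last by exists [fset x]%fset.
    by apply: open_nbhs_nbhs; split; [exact: open_interior|exact: nbhsx_ballx].
  by move=> [x' D] /= [xx']; rewrite fsub1set => xD; exists x.
have {}covD := covD D0 (fsubset_refl _).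
suff c1 : has_cover (orbit_small (@box_pt k 1)) #|{: D0}|.
  by exists (n ^ k * #|{: D0}|)%N; apply: has_cover_box c1; rewrite ?muln1.
exists D0, (fun x => (ball (val x) (e / 2))°); split.
- by move=> x; exact: open_interior.
- move=> z g x y /interior_subset + /interior_subset.
  have -> : box_pt g = 0 by apply/rowP => j; rewrite !mxE ord1.
  rewrite !act0 ballEmdist /= => zx zy.
  apply: (le_trans (metric_triangle _ (val z) _)).
  by rewrite metric_sym [e]splitr lerD// ltW.
- by move=> x; have [//|y yD xy] := covD x; exists [` yD]%fset.
- by move=> x; rewrite (leq_trans (max_card _)).
Qed.

Lemma widim_dist_boxE n m : X -> 0 <= e ->
  has_cover (orbit_small (@box_pt k n)) m ->
  (forall l, has_cover (orbit_small (@box_pt k n)) l -> (m <= l)%N) ->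
  widim (dist_box T n) e = m%:R%:E.
Proof.
move=> x0 e0 cm minm; apply/eqP; rewrite eq_le.
rewrite -diam_dist_box// in cm minm.
rewrite widim_le//= leNgt; apply/negP.
case: m cm minm => [|m] _ minm; first by rewrite ltNge widim_ge0.
by move/widim_lt/minm; rewrite ltnn.
Qed.

End Growth.

Section BoxLimit.
Context {R : realType}.

(** Fekete's lemma for boxes.  With [q = N / n + 1] one gets
    [a N / N ^ k <= (1 + n / N) ^ k * (a n / n ^ k)], so that no value of the
    sequence is exceeded by its upper limit. *)
Lemma cvg_box_density (k : nat) (a : nat -> nat) :
  (forall n q N, (0 < n)%N -> (N <= q * n)%N -> (a N <= q ^ k * a n)%N) ->
  (fun n => (a n)%:R / n%:R ^+ k : R) @ \oo -->
    inf [set (a n)%:R / n%:R ^+ k | n in [set n | (0 < n)%N]].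
Proof.
move=> aP; set b : nat -> R := fun n => _; set B := [set _ | _ in _].
set l := inf B.
have b_ge0 n : 0 <= b n by rewrite divr_ge0// exprn_ge0.
have hB : has_inf B.
  split; first by exists (b 1%N); exists 1%N.
  by exists 0 => _ [n _ <-].
have bl n : (0 < n)%N -> l <= b n.
  by move=> n0; apply: ge_inf; [case: hB|exists n].
rewrite -cvg_shiftS; apply/cvgrPdist_lt => e e0.
have e20 : 0 < e / 2 by rewrite divr_gt0.
have [_ [n /= n0 <-] bn] := inf_adherent e20 hB.
have bound N : (0 < N)%N -> b N <= (1 + n%:R / N%:R) ^+ k * b n.
  move=> N0; pose q := (N %/ n).+1.
  have Nqn : (N <= q * n)%N by rewrite ltnW// -ltn_divLR.
  have NR : 0 < N%:R :> R by rewrite ltr0n.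
  have nR : 0 < n%:R :> R by rewrite ltr0n.
  apply: (@le_trans _ _ ((q%:R * n%:R / N%:R) ^+ k * b n)).
    rewrite /b !exprMn exprVn.
    rewrite [X in _ <= X](_ : _ = (q ^ k * a n)%:R / N%:R ^+ k); last first.
      by rewrite natrM natrX; field; rewrite !expf_neq0// gt_eqF.
    by rewrite ler_pM2r ?invr_gt0 ?exprn_gt0// ler_nat aP.
  rewrite ler_wpM2r// lerXn2r ?nnegrE ?divr_ge0 ?mulr_ge0 ?addr_ge0//.
  rewrite ler_pdivrMr// mulrDl mul1r mulfVK ?gt_eqF//.
  by rewrite -natrM -natrD ler_nat /q mulSn addnC leq_add2r leq_divM.
have cvgbn : (fun N : nat => (1 + n%:R / N.+1%:R) ^+ k * b n) @ \oo -->
    (1 + n%:R * 0) ^+ k * b n.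
  apply: cvgM; last exact: cvg_cst.
  apply: (@cvg_comp _ _ _ (fun N : nat => 1 + n%:R / N.+1%:R)
    (fun x : R => x ^+ k)); last exact: exprn_continuous.
  apply: cvgD; first exact: cvg_cst.
  by apply: cvgM; [exact: cvg_cst|exact: cvg_harmonic].
rewrite mulr0 addr0 expr1n mul1r in cvgbn.
have bnl : b n < l + e / 2 by [].
near=> N.
have bN : b N.+1 < l + e / 2.
  apply: (le_lt_trans (bound N.+1 isT)); near: N.
  exact: (cvgr_lt _ cvgbn).
rewrite distrC ger0_norm ?subr_ge0 ?bl//; lra.
Unshelve. all: by end_near. Qed.

End BoxLimit.

(** The limit in the definition of [mdim] is the infimum of the sequence over
    [n > 0], so a bound on it is a bound for some box. *)
Lemma mdim_small_cover (R : realType) (k : nat) (X : metricType R)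
    (T : Zk_action k X) (c e : R) :
  compact [set: X] -> X -> (mdim T < c%:E)%E -> 0 < e ->
  exists n m, [/\ (0 < n)%N, has_cover (orbit_small T e (@box_pt k n)) m
                & m%:R < c * n%:R ^+ k].
Proof.
move=> cX x0 mdim_lt e0.
have /choice[a aP] n : exists m, has_cover (orbit_small T e (@box_pt k n)) m /\
    forall l, has_cover (orbit_small T e (@box_pt k n)) l -> (m <= l)%N.
  have ex : exists m, `[< has_cover (orbit_small T e (@box_pt k n)) m >].
    by have [m cm] := exists_cover_box T n cX e0; exists m; apply/asboolP.
  case: (ex_minnP ex) => m /asboolP cm minm; exists m; split=> // l cl.
  by apply: minm; apply/asboolP.
have cvg_a := @cvg_box_density R k a _.
have {}cvg_a := cvg_a (fun n q N n0 Nqn =>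
  (aP N).2 _ (has_cover_box n0 Nqn (aP n).1)).
set l := inf _ in cvg_a.
have lim_l :
    limn (fun n => widim (dist_box T n) e * ((n%:R ^+ k)^-1)%:E)%E = l%:E.
  apply/cvg_lim => //.
  rewrite [X in X @ _ --> _](_ : _ = EFin \o (fun n => (a n)%:R / n%:R ^+ k)).
    by apply: cvg_EFin => //; exact: nearW.
  apply/funext => n /=.
  by rewrite (widim_dist_boxE x0 (ltW e0) (aP n).1 (aP n).2) EFinM.
have lc : l < c.
  rewrite -lte_fin -lim_l; apply: le_lt_trans mdim_lt.
  by apply: ereal_sup_ubound; exists e.
have [_ [n /= n0 <-] anc] : exists2 r,
    [set (a n)%:R / n%:R ^+ k | n in [set n | (0 < n)%N]] r & r < c.
  by apply: inf_lt lc; exists ((a 1%N)%:R / 1%:R ^+ k), 1%N.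
exists n, (a n); split=> //; first exact: (aP n).1.
by rewrite -ltr_pdivrMr// exprn_gt0// ltr0n.
Qed.

Section Baire.
Context {R : realType} {M : pseudoMetricType R}.

(** Baire's theorem for a pseudometric space.  Since balls need be neither open nor
    closed, nested closed balls are replaced by balls such that the ball of twice
    the radius still lies in the previous one. *)
Lemma baire_of_cauchy (F : nat -> set M) :
  (forall u : nat -> M, cauchy (u @ \oo) -> exists l : M, u @ \oo --> l) ->
  (forall n, open (F n) /\ dense (F n)) -> dense (\bigcap_n F n).
Proof.
move=> complM oF D D0 oD.
pose good n (p q : M * R) := 0 < q.2 /\ q.2 <= p.2 / 2 /\
  ball q.1 (q.2 * 2) `<=` ball p.1 p.2 `&` F n.
have step n (p : M * R) : 0 < p.2 -> exists q, good n p q.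
  move=> p0; have [oFn dFn] := oF n.
  have [x [px Fx]] : (ball p.1 p.2)° `&` F n !=set0.
    apply: dFn; last exact: open_interior.
    by exists p.1; exact: nbhsx_ballx.
  have : nbhs x ((ball p.1 p.2)° `&` F n).
    apply: open_nbhs_nbhs; split=> //; apply: openI => //.
    exact: open_interior.
  rewrite -nbhs_ballE => -[r /= r0 rF].
  exists (x, Num.min (r / 2) (p.2 / 2)); rewrite /good /=; split.
    by rewrite lt_min !divr_gt0.
  split; first by rewrite ge_min lexx orbT.
  move=> y xy; have [|yp Fy] := rF y.
    apply: le_ball xy; rewrite -ler_pdivlMr//.
    by rewrite ge_min lexx.
  by split=> //; exact: interior_subset.
have /choice[nxt nxtP] (np : nat * (M * R)) :
    exists q, 0 < np.2.2 -> good np.1 np.2 q.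
  have [p0|p0] := pselect (0 < np.2.2); last by exists np.2 => /p0.
  by have [q qP] := step np.1 np.2 p0; exists q.
have [x Dx] := D0.
have : nbhs x D by exact: open_nbhs_nbhs.
rewrite -nbhs_ballE => -[r /= r0 rD].
pose s := fix s n := if n is n'.+1 then nxt (n', s n') else (x, r).
have s_gt0 n : 0 < (s n).2.
  by elim: n => [|n IH] //=; have [] := nxtP (n, s n) IH.
have sP n : good n (s n) (s n.+1) := nxtP (n, s n) (s_gt0 n).
have s_sub n m : ball (s (n + m)%N).1 (s (n + m)%N).2 `<=` ball (s n).1 (s n).2.
  elim: m => [|m IH]; first by rewrite addn0.
  apply: subset_trans IH; rewrite addnS => y.
  have [q0 [_ sub]] := sP (n + m)%N.
  have /le_ball : (s (n + m).+1).2 <= (s (n + m).+1).2 * 2.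
    by rewrite ler_pMr// ler1n.
  by move=> /[apply] /sub[].
have s_in n m : (n <= m)%N -> ball (s n).1 (s n).2 (s m).1.
  move=> nm; apply: (s_sub n (m - n)%N); rewrite subnKC//.
  exact: ballxx.
have s_small n : (s n).2 <= r / 2 ^+ n.
  elim: n => [|n IH]; first by rewrite expr0 divr1.
  have [_ [h _]] := sP n; apply: (le_trans h).
  by rewrite exprSr invfM mulrA ler_pM2r.
have cu : cauchy ((fst \o s) @ \oo).
  apply/cauchy_ballP => e e0.
  have [n sn] : exists n, (s n).2 < e / 2.
    have : (fun n => geometric r 2^-1 n) @ \oo --> (0 : R).
      by apply: cvg_geometric; rewrite ger0_norm ?invr_ge0// invf_lt1// ltr1n.
    move=> /cvgr_lt /(_ (e / 2)); rewrite divr_gt0// => /(_ isT) [n _ nP].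
    exists n; apply: (le_lt_trans (s_small n)).
    by have := nP n (leqnn n); rewrite /geometric /= exprVn.
  rewrite near_map2; near=> p q; have np : (n <= p)%N by near: p; exists n.
  have nq : (n <= q)%N by near: q; exists n.
  rewrite [e]splitr; apply: (@ball_triangle _ _ (s n).1).
    by apply: ball_sym; apply: le_ball (s_in _ _ np); exact: ltW.
  by apply: le_ball (s_in _ _ nq); exact: ltW.
have [y uy] := complM _ cu.
have y_in n : ball (s n).1 ((s n).2 * 2) y.
  have : \forall m \near \oo, ball y (s n).2 (s m).1.
    by apply: uy; exact: nbhsx_ballx.
  move=> [N _ NP]; have := NP (maxn n N) (leq_maxr _ _) => yN.
  rewrite mulr_natr mulr2n; apply: (@ball_triangle _ _ (s (maxn n N)).1).
    exact/s_in/leq_maxl.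
  exact: ball_sym.
exists y; split.
  have [_ [_ sub]] := sP 0%N; have [+ _] := sub _ (y_in 1%N).
  exact: rD.
by move=> n _; have [_ [_ sub]] := sP n; have [] := sub _ (y_in n.+1).
Unshelve. all: by end_near. Qed.

End Baire.

(** * Maps into the cube by coordinates *)

Section CubeValued.
Context {R : realType} {X : topologicalType} {N : nat}.
Implicit Types f g : cts_space X (unit_cube R N).

Definition coord f (i : 'I_N) (x : X) : R := (\val (f x) : 'rV[R]_N) ord0 i.

Lemma coord_cont f i : continuous (coord f i).
Proof.
move=> x; apply: (@cvg_comp _ _ _ (fun x => (\val (f x) : 'rV[R]_N))
  (fun M => M ord0 i)); last exact: coord_continuous.
apply: (@cvg_comp _ _ _ f (fun v : unit_cube R N => (\val v : 'rV[R]_N))).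
  exact: cts_fun.
exact: initial_continuous.
Qed.

Lemma coord01 f i x : 0 <= coord f i x <= 1.
Proof. by have /set_mem := valP (f x); exact. Qed.

Lemma coord_inj f g x y : (forall i, coord f i x = coord g i y) -> f x = g y.
Proof. by move=> e; apply/val_inj/rowP => i; exact: e. Qed.

Lemma exists_with_coords (F : 'I_N -> X -> R) :
  (forall i, continuous (F i)) -> (forall i x, 0 <= F i x <= 1) ->
  exists f, forall i x, coord f i x = F i x.
Proof.
move=> cF F01.
have inC x : (\row_i F i x : 'rV[R]_N) \in unit_cube R N.
  by apply/mem_set => i; rewrite mxE.
pose h x : unit_cube R N := exist _ (\row_i F i x : 'rV[R]_N) (inC x).
have ch : continuous h.
  apply: (@continuous_comp_initial _ _ _
    (fun v : unit_cube R N => (\val v : 'rV[R]_N))).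
  move=> x; apply/cvg_ballP => e e0.
  have : \forall y \near x, forall i, ball (F i x) e (F i y).
    by apply: filter_forall => i; move: (cF i x) => /cvg_ballP /(_ e e0).
  apply: filterS => y yP; split=> // i j.
  by rewrite !mxE.
exists (mkcts ch : continuousType X (unit_cube R N)) => i x.
by rewrite /coord /= mxE.
Qed.

Lemma ball_coord f g (e : R) : 0 < e ->
  ball f e g <-> forall i x, `|coord f i x - coord g i x| < e.
Proof.
move=> e0; split=> [fg i x|fg]; last first.
  suff h x : @mx_ball 1 N R R (\val (f x) : 'rV[R]_N) e (\val (g x)) by exact: h.
  by split=> // a i; rewrite ord1; exact: fg.
have [_ h] : @mx_ball 1 N R R (\val (f x) : 'rV[R]_N) e (\val (g x)) := fg x.
exact: (h ord0 i).
Qed.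

(** The coordinates converge uniformly, and their limits take values in [[0,1]] and
    so assemble to a map into the cube. *)
Lemma cts_space_complete (u : nat -> cts_space X (unit_cube R N)) :
  cauchy (u @ \oo) -> exists l : cts_space X (unit_cube R N), u @ \oo --> l.
Proof.
move=> cu.
have cau (e : R) : 0 < e -> exists n, forall p q i x,
    (n <= p)%N -> (n <= q)%N -> `|coord (u p) i x - coord (u q) i x| < e.
  move=> e0; have /cauchy_ballP/(_ e e0) := cu; rewrite near_map2.
  move=> [[P Q] /= [[n _ nP] [m _ mQ]] PQ]; exists (maxn n m) => p q i x.
  rewrite !geq_max => /andP[np mp] /andP[nq mq].
  move: i x; apply/ball_coord => //; apply: (PQ (p, q)).
  by split; [exact: nP|exact: mQ].
pose F i x := limn (fun n => coord (u n) i x).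
have cF i x : coord (u n) i x @[n --> \oo] --> F i x.
  apply/cauchy_cvgP/cauchy_ballP => e e0; rewrite near_map2.
  have [n nP] := cau e e0; near=> p q.
  have np : (n <= p)%N by near: p; exists n.
  have nq : (n <= q)%N by near: q; exists n.
  exact: nP.
have uF (e : R) : 0 < e -> exists n, forall p i x, (n <= p)%N ->
    `|coord (u p) i x - F i x| <= e.
  move=> /cau[n nP]; exists n => p i x np.
  have cpF : `|coord (u p) i x - coord (u q) i x| @[q --> \oo] -->
      `|coord (u p) i x - F i x|.
    by apply: cvg_norm; apply: cvgB; [exact: cvg_cst|exact: cF].
  apply: (cvgr_to_le cpF); near=> q; apply/ltW/nP => //.
  by near: q; exists n.
have contF i : continuous (F i).
  move=> x; apply/cvgrPdist_le => e e0.
  have e30 : 0 < e / 3 by rewrite divr_gt0.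
  have [n /(_ n i _ (leqnn n)) nP] := uF _ e30.
  have /cvgrPdist_le/(_ _ e30) := @coord_cont (u n) i x.
  apply: filterS => y; have := nP x; have := nP y.
  rewrite !ler_norml => /andP[a1 a2] /andP[b1 b2] /andP[c1 c2].
  apply/andP; split; lra.
have F01 i x : 0 <= F i x <= 1.
  apply/andP; split.
    by apply: (cvgr_to_ge (cF i x)); near=> n; case/andP: (coord01 (u n) i x).
  by apply: (cvgr_to_le (cF i x)); near=> n; case/andP: (coord01 (u n) i x).
have [l lF] := exists_with_coords contF F01.
exists l; apply/cvg_ballP => e e0; have e20 : 0 < e / 2 by rewrite divr_gt0.
have [n nP] := uF _ e20; near=> p; apply/ball_coord => // i x.
rewrite lF distrC; apply: (@le_lt_trans _ _ (e / 2)); last lra.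
by apply: nP; near: p; exists n.
Unshelve. all: by end_near. Qed.

End CubeValued.

(** * Gluing over disjoint closed sets *)

Section Gluing.
Context {R : realType} {X : metricType R}.

Lemma clip_continuous (a b : R) (f : X -> R) : continuous f ->
  continuous (fun x => Num.max a (Num.min b (f x))).
Proof.
move=> cf x; apply: (@continuous_max R _ (cst a) (fun x => Num.min b (f x)) x).
  exact: cst_continuous.
by apply: (@continuous_min R _ (cst b) f x); [exact: cst_continuous|exact: cf].
Qed.

Lemma clip_in (a b v : R) : a <= b -> a <= Num.max a (Num.min b v) <= b.
Proof. by move=> ab; rewrite le_max lexx/= ge_max ab ge_min lexx. Qed.

Lemma clip_id (a b v : R) : a <= v <= b -> Num.max a (Num.min b v) = v.
Proof. by move=> /andP[av vb]; rewrite min_r// max_r. Qed.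

Lemma clip_dist (a b v w : R) : a <= v <= b ->
  `|Num.max a (Num.min b w) - v| <= `|w - v|.
Proof.
move=> /andP[av vb]; have [bw|wb] := leP b w.
  rewrite max_r; last by rewrite (le_trans av).
  by rewrite !ger0_norm ?subr_ge0 ?lerB// (le_trans vb).
have [//|wa] := leP a w.
have wv := ltW (lt_le_trans wa av); rewrite !ler0_norm ?subr_le0//; lra.
Qed.

(** A Tietze-type extension: with [u g] equal to [1] on [A g] and to [0] on the
    other sets, the sum of the [u g * (h g - f)] is the required correction of [f]
    on each [A g].  Elsewhere it may be large, hence the two truncations, which
    change nothing on the [A g]. *)
Lemma glue_on_disjoint_closed (G : finType) (A : G -> set X) (f : X -> R)
    (h : G -> X -> R) (e : R) :
  (forall g, closed (A g)) -> trivIset [set: G] A ->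
  continuous f -> (forall x, 0 <= f x <= 1) ->
  (forall g, continuous (h g)) -> (forall g x, 0 <= h g x <= 1) ->
  (forall g x, A g x -> `|h g x - f x| <= e) -> 0 <= e ->
  exists F : X -> R, [/\ continuous F, forall x, 0 <= F x <= 1,
    forall x, `|F x - f x| <= e & forall g x, A g x -> F x = h g x].
Proof.
move=> cA tA cf f01 ch h01 hf e0.
have [u [cu u1 u0]] := separating_functions cA tA.
pose s x := \sum_g u g x * (h g x - f x).
have cs : continuous s.
  apply: continuous_sum => g x; apply: cvgM; first exact: cu.
  by apply: cvgB; [exact: ch|exact: cf].
pose v x := f x + Num.max (- e) (Num.min e (s x)).
have ve : - e <= e by lra.
exists (fun x => Num.max 0 (Num.min 1 (v x))); split.
- apply: clip_continuous => x; apply: cvgD; first exact: cf.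
  exact: clip_continuous.
- by move=> x; apply: clip_in.
- move=> x; apply: (le_trans (clip_dist _ (f01 x))).
  by rewrite /v addrAC subrr add0r ler_norml clip_in.
- move=> g x Ax; have -> : v x = h g x; last by rewrite clip_id.
  rewrite /v /s (bigD1 g)//= u1// mul1r big1 ?addr0 => [|g' g'g]; last first.
    by rewrite (u0 g' g) ?mul0r// eq_sym.
  have hfe : - e <= h g x - f x <= e by rewrite -ler_norml hf.
  by rewrite clip_id// addrC subrK.
Qed.

End Gluing.

(** * Density of the separating maps *)

Definition separates_at (R : realType) (k N : nat) (X Y : metricType R)
    (T : Zk_action k X) (pi : X -> Y) (e : R) :
    set (cts_space X (unit_cube R N)) :=
  [set f | forall x y, pi x = pi y -> e <= mdist x y ->
    exists w, f (T w x) != f (T w y)].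

(** [x' = - h x] and [y' = - h y] lie over the base [U i] of a tower that has [pi x]
    in its level [h].  The points [b x'] and [b y'] are then over the level [b],
    where the block [i] of [g] takes the values [F i (_, b) x'] and
    [F i (_, b) y'].  If [x] and [y] are not separated then [F i] identifies [x']
    and [y'], which forces [h x' = x] and [h y' = y] to be close. *)
Lemma separates_at_approx (R : realType) (k D L : nat) (X Y : metricType R)
    (T : Zk_action k X) (S : Zk_action k Y) (pi : X -> Y)
    (f : cts_space X (unit_cube R (D.+1 * L))) (e d : R) :
  compact [set: X] -> factor_map T S pi ->
  (forall n, (0 < n)%N ->
    exists U : 'I_D.+1 -> set Y, rokhlin_cover S n U) ->
  (mdim T < (L%:R / 2)%:E)%E -> 0 < e -> 0 < d ->
  exists2 g, ball f d g & separates_at T pi e g.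
Proof.
move=> X_compact pi_factor rokhlin mdim_X e0 d0.
have [x0|X0] := pselect (exists x : X, True); last first.
  by exists f => [|x]; [exact: ballxx|case: X0; exists x].
have {}x0 : X by case: (cid x0).
have d20 : 0 < d / 2 by rewrite divr_gt0.
have d40 : 0 < d / 2 / 2 by rewrite divr_gt0.
have [cpi _ epi] := pi_factor.
have [r r0 fr] : exists2 r, 0 < r & forall c x y, mdist x y <= r ->
    `|coord f c x - coord f c y| <= d / 2 / 2.
  have /choice[r rP] (c : 'I_(D.+1 * L)) : exists r, 0 < r /\
      forall x y, mdist x y <= r -> `|coord f c x - coord f c y| <= d / 2 / 2.
    have [r r0 rP] := uniform_modulus X_compact (@coord_cont _ _ _ f c) d40.
    by exists r.
  exists (\big[Num.min/1]_c r c).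
    by elim/big_ind: _ => // [a b a0 b0|c _]; [rewrite lt_min a0|case: (rP c)].
  move=> c x y xy; have [_ rcP] := rP c; apply: rcP; apply: (le_trans xy).
  exact: bigmin_le.
pose e' := Num.min r (e / 2).
have e'0 : 0 < e' by rewrite lt_min r0 divr_gt0.
have [n [m [n0 [I [V [oV sV covV multV]]] mn]]] :=
  mdim_small_cover X_compact x0 mdim_X e'0.
have [U [oU tU covU]] := rokhlin n n0.
pose J : finType := ('I_L * 'rV['I_n]_k)%type.
(* Here [mdim < L / 2] becomes the dimension count of [generic_map]. *)
have mJ : (m.*2 < #|J|)%N.
  rewrite card_prod card_ord card_mx card_ord mul1n -(ltr_nat R) natrM natrX.
  by rewrite -muln2 natrM -ltr_pdivlMr// mulrAC.
have /choice[F FP] (i : 'I_D.+1) : exists F : J -> X -> R,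
    [/\ forall j, continuous (F j), forall j x, 0 <= F j x <= 1,
        forall j x,
          `|F j x - coord f (mxvec_index i j.1) (T (box_pt j.2) x)| <= d / 2
      & forall x y, (forall j, F j x = F j y) -> exists2 a, V a x & V a y].
  apply: (generic_map oV covV multV mJ d20) => [j x|j x|a j x y Vx Vy].
  - apply: (@cvg_comp _ _ _ (T (box_pt j.2)) (coord f (mxvec_index i j.1))).
      exact: act_continuous.
    exact: coord_cont.
  - exact: coord01.
  - apply: fr; apply: (le_trans (sV a j.2 _ _ Vx Vy)).
    by rewrite ge_min lexx.
pose A (i : 'I_D.+1) (h : 'rV['I_n]_k) : set X :=
  [set x | closure (U i) (S (- box_pt h) (pi x))].
have cA i h : closed (A i h).
  have cS : continuous (fun x => S (- box_pt h) (pi x)).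
    move=> x; apply: (@cvg_comp _ _ _ pi (S (- box_pt h))); first exact: cpi.
    exact: act_continuous.
  by apply: (continuous_closedP _).1 cS _ _; exact: closed_closure.
have tA i : trivIset [set: 'rV['I_n]_k] (A i).
  move=> h h' _ _ [x [Ax Ax']]; apply: (tU i) => //; exists (pi x); split.
    by exists (S (- box_pt h) (pi x)) => //; rewrite -actD subrr act0.
  by exists (S (- box_pt h') (pi x)) => //; rewrite -actD subrr act0.
have /choice[G GP] (il : 'I_D.+1 * 'I_L) : exists G : X -> R,
    [/\ continuous G, forall x, 0 <= G x <= 1,
        forall x, `|G x - coord f (mxvec_index il.1 il.2) x| <= d / 2
      & forall h x, A il.1 h x -> G x = F il.1 (il.2, h) (T (- box_pt h) x)].
  have [cF F01 Ff _] := FP il.1.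
  apply: (glue_on_disjoint_closed (cA il.1) (tA il.1)) => //.
  - exact: coord_cont.
  - by move=> x; exact: coord01.
  - move=> h x; apply: (@cvg_comp _ _ _ (T (- box_pt h)) (F il.1 (il.2, h))).
      exact: act_continuous.
    exact: cF.
  - move=> h x _; have := Ff (il.2, h) (T (- box_pt h) x).
    by rewrite /= -actD subrr act0.
  - exact: ltW.
have [dec decK _] := curry_mxvec_bij D.+1 L.
have [|c x|g gG] := @exists_with_coords R X _ (fun c => G (dec c)).
- by move=> c; have [] := GP (dec c).
- by have [] := GP (dec c).
have gGil i l x : coord g (mxvec_index i l) x = G (i, l) x.
  by rewrite gG; congr (G _ x); apply: (decK (i, l)).
have encK (c : 'I_(D.+1 * L)) : exists i l, c = mxvec_index i l.
  by case: (mxvec_indexP c) => i l; exists i, l.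
exists g.
  apply/ball_coord => // c x; have [i [l cE]] := encK c; rewrite cE.
  rewrite gGil distrC; have [_ _ Gf _] := GP (i, l).
  by apply: le_lt_trans (Gf x) _; lra.
move=> x y pixy exy; apply: contrapT => /forallNP same.
have {}same w c : coord g c (T w x) = coord g c (T w y).
  by rewrite /coord; have /negP := same w; rewrite negbK => /eqP ->.
have : setT (pi x) by [].
rewrite -covU => -[i _ [h _ [z Uz Szx]]].
have [_ _ _ Finj] := FP i.
pose x' := T (- box_pt h) x; pose y' := T (- box_pt h) y.
have pix' : pi x' = z by rewrite epi -Szx -actD addNr act0.
have piy' : pi y' = z by rewrite epi -pixy -Szx -actD addNr act0.
have inA b v : pi v = z -> A i b (T (box_pt b) v).
  move=> vz; rewrite /A /= epi -actD addNr act0 vz.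
  exact: subset_closure.
have [[l b]|a Vx Vy] := Finj x' y'.
  have [_ _ _ Gh] := GP (i, l).
  have := Gh b _ (inA b _ pix'); have := Gh b _ (inA b _ piy'); 
  rewrite /x' /y' /= -!actD !addKr => <- <-.
  by rewrite -!gGil same.
have := sV a h _ _ Vx Vy; rewrite -!actD subrr !act0 leNgt => /negP; apply.
apply: lt_le_trans exy; apply: (@le_lt_trans _ _ (e / 2)); last lra.
by rewrite ge_min lexx orbT.
Qed.

(** * Openness, and the embedding theorem *)

Section Openness.
Context {R : realType} {k N : nat} {X Y : metricType R}.
Variables (T : Zk_action k X) (S : Zk_action k Y) (pi : X -> Y).

Local Notation C := (cts_space X (unit_cube R N)).

(** For each pair [(x, y)] the defining condition holds for all pairs near [(x, y)]
    and all maps near [f]; compactness of [X * X] makes it hold near [f] for all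
    pairs at once. *)
Lemma open_separates_at (e : R) : compact [set: X] -> continuous pi ->
  open (separates_at T pi e : set C).
Proof.
move=> cX cpi; rewrite openE => f sf.
have cXX : compact [set: X * X] by rewrite -setXTT; exact: compact_setX.
pose P (g : C) (p : X * X) := pi p.1 = pi p.2 -> e <= mdist p.1 p.2 ->
  exists w, g (T w p.1) != g (T w p.2).
suff : \forall g \near f, [set: X * X] `<=` P g.
  by apply: filterS => g gP x y; exact: (gP (x, y) I).
apply: ((compact_near_coveringP _).1 cXX _ (nbhs f) P) => -[x y] _.
have near_x (d : R) : 0 < d -> \forall x' \near x, mdist x x' < d.
  exact: (metricType_numDomainType.cvgr_dist_lt (f := id)).
have near_y (d : R) : 0 < d -> \forall y' \near y, mdist y y' < d.
  exact: (metricType_numDomainType.cvgr_dist_lt (f := id)).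
have [pixy|pixy] := pselect (pi x = pi y); last first.
  pose d := mdist (pi x) (pi y) / 2.
  have d0 : 0 < d by rewrite divr_gt0// mdist_gt0; exact/eqP.
  exists ([set p | mdist (pi x) (pi p.1) < d /\
    mdist (pi y) (pi p.2) < d], setT).
    split; last exact: filterT.
    exists ([set x' | mdist (pi x) (pi x') < d],
      [set y' | mdist (pi y) (pi y') < d]) => //.
    by split; apply: (metricType_numDomainType.cvgr_dist_lt (f := pi)) => //;
      exact: cpi.
  move=> [[x' y'] g] /= [[xx' yy'] _] pixy'; exfalso.
  have := metric_triangle (pi x) (pi x') (pi y).
  rewrite pixy' [mdist (pi y') _]metric_sym leNgt => /negP; apply.
  rewrite /d ?pixy' in xx' yy'; lra.
have [exy|exy] := leP e (mdist x y); last first.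
  pose d := (e - mdist x y) / 2.
  have d0 : 0 < d by rewrite divr_gt0// subr_gt0.
  exists ([set p | mdist x p.1 < d /\ mdist y p.2 < d], setT).
    split; last exact: filterT.
    exists ([set x' | mdist x x' < d], [set y' | mdist y y' < d]) => //.
    by split; [exact: near_x|exact: near_y].
  move=> [[x' y'] g] /= [[xx' yy'] _] _ exy'; exfalso.
  have := metric_triangle x' x y'; have := metric_triangle x y y'.
  by rewrite [mdist x' x]metric_sym; rewrite /d in xx' yy'; lra.
have [w fw] := sf x y pixy exy.
have [c fc] : exists c, coord f c (T w x) != coord f c (T w y).
  apply: contrapT => /forallNP h; move/eqP: fw; apply; apply: coord_inj => c.
  by apply/eqP; have /negP := h c; rewrite negbK.
pose d := `|coord f c (T w x) - coord f c (T w y)| / 4.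
have d0 : 0 < d by rewrite divr_gt0// normr_gt0 subr_eq0.
have cT z : \forall z' \near z, `|coord f c (T w z) - coord f c (T w z')| < d.
  have cf : continuous (fun z => coord f c (T w z)).
    move=> v; apply: (@cvg_comp _ _ _ (T w) (coord f c)).
      exact: act_continuous.
    exact: coord_cont.
  by have /cvgrPdist_lt/(_ d d0) := cf z.
exists ([set p | `|coord f c (T w x) - coord f c (T w p.1)| < d /\
    `|coord f c (T w y) - coord f c (T w p.2)| < d], ball f d).
  split; last exact: nbhsx_ballx.
  by exists ([set x' | `|coord f c (T w x) - coord f c (T w x')| < d],
    [set y' | `|coord f c (T w y) - coord f c (T w y')| < d]) => //;
    split; exact: cT.
move=> [[x' y'] g] /= [[xx' yy'] /(ball_coord _ _ d0) fg] _ _; exists w.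
apply/negP => /eqP gxy.
have gcxy : coord g c (T w x') = coord g c (T w y') by rewrite /coord gxy.
have fgx := fg c (T w x'); have fgy := fg c (T w y'); rewrite -gcxy in fgy.
have : `|coord f c (T w x) - coord f c (T w y)| = d * 4 by rewrite /d divfK.
have -> : coord f c (T w x) - coord f c (T w y) =
  (coord f c (T w x) - coord f c (T w x'))
  + (coord f c (T w x') - coord g c (T w x'))
  - (coord f c (T w y') - coord g c (T w x'))
  - (coord f c (T w y) - coord f c (T w y')).
  by lra.
move=> dE; suff : d * 4 < d * 4 by rewrite ltxx.
rewrite -[ltLHS]dE; apply: (le_lt_trans (ler_normB _ _)).
apply: (@lt_le_trans _ _ (d + d + d + d)); last lra.
apply: ltrD => //; apply: (le_lt_trans (ler_normB _ _)); apply: ltrD => //.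
by apply: (le_lt_trans (ler_normD _ _)); apply: ltrD.
Qed.

Lemma orbit_map_continuous (f : C) : continuous (orbit_map T f).
Proof.
move=> x.
have F : Filter (orbit_map T f y @[y --> x]).
  by apply: fmap_filter; exact: nbhs_filter.
apply/cvg_sup => w A [B [[V oV <-] Vx VA]].
have cfw : (fun y => f (T w y)) y @[y --> x] --> f (T w x).
  apply: (@cvg_comp _ _ _ (T w) f); first exact: act_continuous.
  exact: cts_fun.
have : nbhs (f (T w x)) V by exact: open_nbhs_nbhs.
by move/cfw; apply: (@filterS _ _ (nbhs_filter x)) => y; exact: VA.
Qed.

Lemma embedding_orbit_mapP (f : C) : factor_map T S pi ->
  embedding T (diag_action (shift_action R k N) S)
    (fun x => (orbit_map T f x, pi x)) <->
  forall n : nat, separates_at T pi n.+1%:R^-1 f.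
Proof.
move=> [cpi _ epi]; split=> [[_ inj _] n x y pixy nxy|sep].
  apply: contrapT => /forallNP same.
  have xy : x = y.
    apply: inj; congr pair => //; apply/funext => w; rewrite /orbit_map.
    by apply/eqP; have /negP := same w; rewrite negbK.
  by move: nxy; rewrite xy mdistxx leNgt invr_gt0 ltr0n.
split.
- by move=> x; exact: (cvg_pair (@orbit_map_continuous f x) (cpi x)).
- move=> x y [fxy pixy]; apply/eqP; apply: contraT.
  rewrite -(mdist_gt0 x y) => xy0.
  have [n nxy] : exists n : nat, n.+1%:R^-1 < mdist x y.
    by have [n] := ltr_add_invr xy0; rewrite add0r; exists n.
  have [w] := sep n x y pixy (ltW nxy).
  by have /(congr1 (@^~ w)) := fxy; rewrite /orbit_map => ->; rewrite eqxx.
- move=> g x; rewrite /= /diag_fun /= epi; congr pair; apply/funext => w.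
  by rewrite /orbit_map /shift_fun -actD.
Qed.

End Openness.

(** An infimum of naturals that is finite is attained. *)
Lemma dim_Rok_attained (R : realType) (k D : nat) (Y : metricType R)
    (S : Zk_action k Y) : dim_Rok S = (D%:R)%:E ->
  forall n, (0 < n)%N -> exists U : 'I_D.+1 -> set Y, rokhlin_cover S n U.
Proof.
move=> dimD.
have [_ [D' D'P <-]] : exists2 y, [set (D%:R)%:E | D in [set D : nat |
    forall n, (0 < n)%N -> exists U : 'I_D.+1 -> set Y, rokhlin_cover S n U]] y &
    (y < (D.+1%:R : R)%:E)%E.
  by apply: ereal_inf_lt; rewrite -/(dim_Rok S) dimD lte_fin ltr_nat.
rewrite lte_fin ltr_nat ltnS => D'D.
suff -> : D = D' by [].
apply/eqP; rewrite eqn_leq D'D andbT -(ler_nat R) -lee_fin -dimD.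
by apply: ereal_inf_lbound; exists D'.
Qed.

Theorem theorem2 (R : realType) (k D L : nat) (X Y : metricType R)
  (T : Zk_action k X) (S : Zk_action k Y) (pi : X -> Y)
  (k_ge1 : (1 <= k)%N) (L_ge1 : (1 <= L)%N)
  (X_compact : compact [set: X]) (Y_compact : compact [set: Y])
  (pi_factor : factor_map T S pi)
  (dim_Y : dim_Rok S = (D%:R)%:E)
  (mdim_X : (mdim T < (L%:R / 2)%:E)%E) :
  let N := (D.+1 * L)%N in
  let sigma_S := diag_action (shift_action R k N) S in
  let E := [set f : cts_space X (unit_cube R N) |
             embedding T sigma_S (fun x => (orbit_map T f x, pi x))] in
  [/\ dense E, Gdelta E
    & exists phi : X -> shift_space R k N * Y, embedding T sigma_S phi].
Proof.
move=> N sigma_S E.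
have [cpi _ _] := pi_factor.
pose F n : set (cts_space X (unit_cube R N)) := separates_at T pi n.+1%:R^-1.
have oF n : open (F n) by exact: open_separates_at.
have dF n : dense (F n).
  move=> O [f Of] oO.
  have : nbhs f O by exact: open_nbhs_nbhs.
  rewrite -nbhs_ballE => -[d /= d0 dO].
  have n0 : 0 < n.+1%:R^-1 :> R by rewrite invr_gt0.
  have [g fg sg] := separates_at_approx f X_compact pi_factor
    (dim_Rok_attained dim_Y) mdim_X n0 d0.
  by exists g; split=> //; exact: dO.
have EF : E = \bigcap_n F n.
  apply/seteqP; split=> f.
    by move=> /(embedding_orbit_mapP _ pi_factor) fs n _; exact: fs.
  by move=> fs; apply/(embedding_orbit_mapP _ pi_factor) => n; exact: fs.
have dE : dense E.
  by rewrite EF; apply: baire_of_cauchy => //; exact: cts_space_complete.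
split=> //; first by exists F.
have [f0 _] : exists f : cts_space X (unit_cube R N),
    forall i x, coord f i x = 0.
  apply: (exists_with_coords (F := fun _ _ => 0)) => [i|i x].
    exact: cst_continuous.
  by rewrite lexx ler01.
have [f [_ Ef]] : setT `&` E !=set0.
  by apply: dE; [exists f0|exact: openT].
by exists (fun x => (orbit_map T f x, pi x)).
Qed.
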